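(* Let $(V,\mu,R)$ be a braided algebra over a unital commutative ring $\mathbb{k}$. Then the sequence $$C^0_{\rm YBH}(V,V)\longrightarrow C^1_{\rm YBH}(V,V)\xrightarrow{\ \delta^1_{\rm YBH}\ }C^2_{\rm YBH}(V,V)\xrightarrow{\ \delta^2_{\rm YBH}\ }C^3_{\rm YBH}(V,V)$$ is a cochain complex.
   Context: $\mathbb{k}$ is a unital commutative ring, $\otimes=\otimes_{\mathbb{k}}$, $\mathrm{Hom}=\mathrm{Hom}_{\mathbb{k}}$, and $1$ denotes the identity map of $V$. A Yang-Baxter (YB) operator on a $\mathbb{k}$-module $V$ is an invertible map $R:V\otimes V\to V\otimes V$ with $(R\otimes 1)(1\otimes R)(R\otimes 1)=(1\otimes R)(R\otimes 1)(1\otimes R)$. A braided algebra $(V,\mu,R)$ is an associative $\mathbb{k}$-algebra $(V,\mu)$ with a YB operator $R$ on $V$ satisfying (YI) $(1\otimes\mu)(R\otimes 1)(1\otimes R)=R(\mu\otimes 1)$ and (IY) $(\mu\otimes 1)(1\otimes R)(R\otimes 1)=R(1\otimes\mu)$. Cochain groups: $C^0_{\rm YBH}(V,V)=0$; $C^1_{\rm YBH}(V,V)=\mathrm{Hom}(V,V)$; $C^2_{\rm YBH}(V,V)=\mathrm{Hom}(V^{\otimes 2},V^{\otimes 2})\oplus\mathrm{Hom}(V^{\otimes 2},V)$, with elements written $\phi\oplus\psi$; $C^3_{\rm YBH}(V,V)=\mathrm{Hom}(V^{\otimes 3},V^{\otimes 3})\oplus C^{3,2}_{\rm YI}\oplus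 C^{3,2}_{\rm IY}\oplus\mathrm{Hom}(V^{\otimes 3},V)$, where $C^{3,2}_{\rm YI}$ and $C^{3,2}_{\rm IY}$ are two copies of $\mathrm{Hom}(V^{\otimes 3},V^{\otimes 2})$. Differentials: $\delta^1_{\rm YBH}(f)=\delta^1_{\rm YB}(f)\oplus\delta^1_{\rm H}(f)$ and $\delta^2_{\rm YBH}(\phi\oplus\psi)=\delta^2_{\rm YB}(\phi)\oplus\delta^2_{\rm YI}(\phi\oplus\psi)\oplus\delta^2_{\rm IY}(\phi\oplus\psi)\oplus\delta^2_{\rm H}(\psi)$, where $\delta^1_{\rm YB}(f)=R(f\otimes 1)+R(1\otimes f)-(f\otimes 1)R-(1\otimes f)R$; $\delta^1_{\rm H}(f)=\mu(f\otimes 1)+\mu(1\otimes f)-f\mu$; $\delta^2_{\rm YB}(\phi)=(R\otimes 1)(1\otimes R)(\phi\otimes 1)+(R\otimes 1)(1\otimes\phi)(R\otimes 1)+(\phi\otimes 1)(1\otimes R)(R\otimes 1)-(1\otimes R)(R\otimes 1)(1\otimes\phi)-(1\otimes R)(\phi\otimes 1)(1\otimes R)-(1\otimes\phi)(R\otimes 1)(1\otimes R)$; $\delta^2_{\rm H}(\psi)=\mu(\psi\otimes 1)+\psi(\mu\otimes 1)-\mu(1\otimes\psi)-\psi(1\otimes\mu)$; $\delta^2_{\rm YI}(\phi\oplus\psi)=(1\otimes\psi)(R\otimes 1)(1\otimes R)+(1\otimes\mu)(\phi\otimes 1)(1\otimes R)+(1\otimes\mu)(R\otimes 1)(1\otimes\phi)-R(\psi\otimes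 1)-\phi(\mu\otimes 1)$; $\delta^2_{\rm IY}(\phi\oplus\psi)=(\psi\otimes 1)(1\otimes R)(R\otimes 1)+(\mu\otimes 1)(1\otimes\phi)(R\otimes 1)+(\mu\otimes 1)(1\otimes R)(\phi\otimes 1)-R(1\otimes\psi)-\phi(1\otimes\mu)$. *)

(* Defs.v *)
From HB Require Import structures.
From mathcomp Require Import all_boot all_algebra.
From mathcomp Require Import boolp functions.

Set Implicit Arguments.
Unset Strict Implicit.
Unset Printing Implicit Defensive.

Import GRing.Theory.
Local Open Scope quotient_scope.
Local Open Scope ring_scope.

Section LinearHom.
Variables (k : comPzRingType) (U V : lmodType k).

Definition is_linear : {pred U -> V} := fun f => `[< linear f >].

Lemma is_linear_submod : submod_closed is_linear.
Proof.
split=> [|a f g /asboolP lf /asboolP lg]; apply/asboolP => b x y.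
  by rewrite scaler0 addr0.
rewrite !fctE lf lg !scalerDr !scalerA (mulrC a b) -!addrA; congr (_ + _).
by rewrite addrCA.
Qed.

HB.instance Definition _ :=
  GRing.isSubmodClosed.Build k (U -> V) is_linear is_linear_submod.

Record LHom := MkLHom { hom_fun :> U -> V; hom_subproof : hom_fun \in is_linear }.

HB.instance Definition _ := [isSub for hom_fun].
HB.instance Definition _ := [Choice of LHom by <:].
HB.instance Definition _ := [SubChoice_isSubLmodule of LHom by <:].

Lemma hom_linear (f : LHom) : linear f.
Proof. exact/asboolP/hom_subproof. Qed.

HB.instance Definition _ (f : LHom) :=
  GRing.isLinear.Build k U V *:%R (hom_fun f) (hom_linear f).

Lemma homD (f : LHom) x y : f (x + y) = f x + f y. Proof. exact: linearD. Qed.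
Lemma homZ (f : LHom) a x : f (a *: x) = a *: f x. Proof. exact: linearZ. Qed.
Lemma hom0 (f : LHom) : f 0 = 0. Proof. exact: linear0. Qed.

Definition mkLHom (f : U -> V) (lf : linear f) : LHom := MkLHom (asboolT lf).

Lemma homP (f g : LHom) : f =1 g -> f = g.
Proof. by move=> fg; apply/val_inj/funext. Qed.

End LinearHom.

Section LinearHomCategory.
Variable k : comPzRingType.
Implicit Types U V W : lmodType k.

Fact hom_id_subproof U : linear (@id U).
Proof. by []. Qed.

Definition hom_id U : LHom U U := mkLHom (@hom_id_subproof U).

Fact hom_comp_subproof U V W (g : LHom V W) (f : LHom U V) : linear (g \o f).
Proof. by move=> a x y; rewrite /= !linearP. Qed.

Definition hom_comp U V W (g : LHom V W) (f : LHom U V) : LHom U W :=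
  mkLHom (hom_comp_subproof g f).

Lemma hom_compE U V W (g : LHom V W) (f : LHom U V) x : hom_comp g f x = g (f x).
Proof. by []. Qed.

End LinearHomCategory.

Arguments hom_id {k U}, {k} U.

Reserved Notation "g \oh f" (at level 40, left associativity).
Notation "g \oh f" := (hom_comp g f) : ring_scope.

(* The tensor product is the free commutative monoid on U x V (lists of pairs, *)
(* read as formal sums of pure tensors) modulo the congruence generated by     *)
(* biadditivity, balancedness and 0 (x) v = 0. Opposites come for free, and    *)
(* [tensor_universal] below is the usual universal property.                   *)
Section TensorProduct.
Variables (k : comPzRingType) (U V : lmodType k).
Implicit Types (u : U) (v : V) (s t : seq (U * V)).

Inductive tensor_eqv : seq (U * V) -> seq (U * V) -> Prop :=
| TensorRefl s : tensor_eqv s s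
| TensorSym s t : tensor_eqv s t -> tensor_eqv t s
| TensorTrans t s s' : tensor_eqv s t -> tensor_eqv t s' -> tensor_eqv s s'
| TensorCat s s' t t' :
    tensor_eqv s s' -> tensor_eqv t t' -> tensor_eqv (s ++ t) (s' ++ t')
| TensorComm s t : tensor_eqv (s ++ t) (t ++ s)
| TensorAddl u u' v : tensor_eqv [:: (u + u', v)] [:: (u, v); (u', v)]
| TensorAddr u v v' : tensor_eqv [:: (u, v + v')] [:: (u, v); (u, v')]
| TensorScale a u v : tensor_eqv [:: (a *: u, v)] [:: (u, a *: v)]
| TensorZero v : tensor_eqv [:: (0, v)] [::].

Definition tensor_rel : rel (seq (U * V)) := fun s t => `[< tensor_eqv s t >].

Fact tensor_rel_refl : reflexive tensor_rel.
Proof. by move=> s; apply/asboolP/TensorRefl. Qed.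

Fact tensor_rel_sym : symmetric tensor_rel.
Proof. by move=> s t; apply/asboolP/asboolP; apply: TensorSym. Qed.

Fact tensor_rel_trans : transitive tensor_rel.
Proof. by move=> t s r /asboolP h1 /asboolP h2; apply/asboolP/(TensorTrans h1). Qed.

Canonical tensor_equiv :=
  EquivRel tensor_rel tensor_rel_refl tensor_rel_sym tensor_rel_trans.

Definition tensor_type := {eq_quot tensor_equiv}.

HB.instance Definition _ := Choice.on tensor_type.
HB.instance Definition _ := EqQuotient.on tensor_type.

Definition tcls s : tensor_type := \pi_tensor_type s.

Lemma tclsP s t : tensor_eqv s t <-> tcls s = tcls t.
Proof.
split=> [st|]; first by apply/eqquotP/asboolP.
by move/eqquotP/asboolP.
Qed.

Lemma tcls_ind (P : tensor_type -> Prop) : (forall s, P (tcls s)) -> forall x, P x.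
Proof. by move=> Ps; elim/quotW. Qed.

Lemma tensor_eqv_mid p q s t :
  tensor_eqv (p :: s ++ q :: t) ([:: p; q] ++ (s ++ t)).
Proof.
have -> : p :: s ++ q :: t = ([:: p] ++ (s ++ [:: q])) ++ t by rewrite /= -catA.
have -> : [:: p; q] ++ (s ++ t) = ([:: p] ++ ([:: q] ++ s)) ++ t by [].
apply: TensorCat (TensorRefl _); apply: TensorCat (TensorRefl _) _.
exact: TensorComm.
Qed.

Lemma tensor_eqv_map (f : U -> U) :
    {morph f : u u' / u + u'} -> (forall a, {morph f : u / a *: u}) -> f 0 = 0 ->
  forall s t, tensor_eqv s t ->
  tensor_eqv [seq (f p.1, p.2) | p <- s] [seq (f p.1, p.2) | p <- t].
Proof.
move=> fD fZ f0 s t; elim=> {s t} /=.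
- by move=> s; apply: TensorRefl.
- by move=> s t _; apply: TensorSym.
- by move=> t s s' _ h _; apply: TensorTrans.
- by move=> s s' t t' _ hs _ ht; rewrite !map_cat; apply: TensorCat.
- by move=> s t; rewrite !map_cat; apply: TensorComm.
- by move=> u u' v; rewrite fD; apply: TensorAddl.
- by move=> u v v'; apply: TensorAddr.
- by move=> a u v; rewrite fZ; apply: TensorScale.
- by move=> v; rewrite f0; apply: TensorZero.
Qed.

Definition tensor_zero := tcls [::].
Definition tensor_add (x y : tensor_type) := tcls (repr x ++ repr y).
Definition tensor_scale a (x : tensor_type) := tcls [seq (a *: p.1, p.2) | p <- repr x].
Definition tensor_opp (x : tensor_type) := tcls [seq (- p.1, p.2) | p <- repr x].

Lemma repr_eqv s : tensor_eqv (repr (tcls s)) s.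
Proof. by apply/tclsP; rewrite /tcls reprK. Qed.

Lemma tensor_addE s t : tensor_add (tcls s) (tcls t) = tcls (s ++ t).
Proof. by apply/tclsP/TensorCat; apply: repr_eqv. Qed.

Lemma tensor_scaleE a s :
  tensor_scale a (tcls s) = tcls [seq (a *: p.1, p.2) | p <- s].
Proof.
apply/tclsP/tensor_eqv_map/repr_eqv; last exact: scaler0.
  exact: scalerDr.
by move=> b u; rewrite !scalerA mulrC.
Qed.

Lemma tensor_oppE s : tensor_opp (tcls s) = tcls [seq (- p.1, p.2) | p <- s].
Proof.
apply/tclsP/tensor_eqv_map/repr_eqv; last exact: oppr0.
  exact: opprD.
by move=> b u; rewrite scalerN.
Qed.

Fact tensor_addA : associative tensor_add.
Proof.
elim/tcls_ind=> s; elim/tcls_ind=> t; elim/tcls_ind=> r.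
by rewrite !tensor_addE catA.
Qed.

Fact tensor_addC : commutative tensor_add.
Proof.
elim/tcls_ind=> s; elim/tcls_ind=> t; rewrite !tensor_addE.
exact/tclsP/TensorComm.
Qed.

Fact tensor_add0 : left_id tensor_zero tensor_add.
Proof. by elim/tcls_ind=> s; rewrite tensor_addE. Qed.

Fact tensor_addN : left_inverse tensor_zero tensor_opp tensor_add.
Proof.
elim/tcls_ind=> s; rewrite tensor_oppE tensor_addE; apply/tclsP.
elim: s => [|[u v] s IHs] /=; first exact: TensorRefl.
apply: (TensorTrans (t := [:: (- u, v); (u, v)] ++
   ([seq (- p.1, p.2) | p <- s] ++ s))).
  exact: tensor_eqv_mid.
apply: (@TensorCat _ [::] _ [::]) IHs.
apply: (TensorTrans _ (TensorZero v)).
by rewrite -(addNr u); apply/TensorSym/TensorAddl.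
Qed.

HB.instance Definition _ := GRing.isZmodule.Build tensor_type
  tensor_addA tensor_addC tensor_add0 tensor_addN.

Fact tensor_scaleA a b x :
  tensor_scale a (tensor_scale b x) = tensor_scale (a * b) x.
Proof.
elim/tcls_ind: x => s; rewrite !tensor_scaleE -map_comp.
by congr tcls; apply: eq_map => p /=; rewrite scalerA.
Qed.

Fact tensor_scale1 : left_id 1 tensor_scale.
Proof.
elim/tcls_ind=> s; rewrite tensor_scaleE; congr tcls.
by rewrite -[RHS]map_id; apply: eq_map => -[u v] /=; rewrite scale1r.
Qed.

Fact tensor_scaleDr : right_distributive tensor_scale +%R.
Proof.
move=> a; elim/tcls_ind=> s; elim/tcls_ind=> t; rewrite /GRing.add /=.
by rewrite tensor_addE !tensor_scaleE tensor_addE map_cat.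
Qed.

Fact tensor_scaleDl x : {morph tensor_scale^~ x : a b / a + b}.
Proof.
move=> a b; elim/tcls_ind: x => s; rewrite [RHS]/GRing.add /=.
rewrite !tensor_scaleE tensor_addE; apply/tclsP.
elim: s => [|[u v] s IHs] /=; first exact: TensorRefl.
apply: (TensorTrans (t := [:: (a *: u, v); (b *: u, v)] ++
   ([seq (a *: p.1, p.2) | p <- s] ++ [seq (b *: p.1, p.2) | p <- s]))).
  by apply: (@TensorCat [:: _]) IHs; rewrite scalerDl; apply: TensorAddl.
exact/TensorSym/tensor_eqv_mid.
Qed.

HB.instance Definition _ := GRing.Zmodule_isLmodule.Build k tensor_type
  tensor_scaleA tensor_scale1 tensor_scaleDr tensor_scaleDl.

Definition tensor : lmodType k := tensor_type.

Lemma tclsD s t : (tcls s : tensor) + tcls t = tcls (s ++ t).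
Proof. exact: tensor_addE. Qed.

Lemma tclsZ a s : a *: (tcls s : tensor) = tcls [seq (a *: p.1, p.2) | p <- s].
Proof. exact: tensor_scaleE. Qed.

Definition pure u v : tensor := tcls [:: (u, v)].

Definition bilinear_map (W : lmodType k) (b : U -> V -> W) :=
  (forall v, linear (b^~ v)) /\ (forall u, linear (b u)).

Lemma pure_bilinear : bilinear_map pure.
Proof.
split=> [v|u] a x y; rewrite /pure tclsZ tclsD; apply/tclsP => /=.
  exact: TensorAddl.
apply: (TensorTrans (TensorAddr _ _ _)).
by apply: (@TensorCat [:: _] [:: _]) (TensorRefl _); apply/TensorSym/TensorScale.
Qed.

Lemma tensor_ind (P : tensor -> Prop) :
    P 0 -> (forall u v x, P x -> P (pure u v + x)) -> forall x, P x.
Proof.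
move=> P0 PD; elim/tcls_ind; elim=> [|[u v] s IHs]; first exact: P0.
by move: (PD u v _ IHs); rewrite tclsD.
Qed.

Lemma tensor_ext (W : lmodType k) (f g : LHom tensor W) :
  (forall u v, f (pure u v) = g (pure u v)) -> f = g.
Proof.
move=> fg; apply: homP; elim/tensor_ind => [|u v x IHx]; first by rewrite !hom0.
by rewrite !homD fg IHx.
Qed.

Section Lift.
Variables (W : lmodType k) (b : U -> V -> W).

Definition tensor_lift_fun (x : tensor) : W := \sum_(p <- repr x) b p.1 p.2.

Hypothesis b_bilin : bilinear_map b.

Let bDl u u' v : b (u + u') v = b u v + b u' v.
Proof. by have := b_bilin.1 v 1 u u'; rewrite !scale1r. Qed.
Let bDr u v v' : b u (v + v') = b u v + b u v'.
Proof. by have := b_bilin.2 u 1 v v'; rewrite !scale1r. Qed.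
Let b0l v : b 0 v = 0.
Proof. by apply: (@addrI _ (b 0 v)); rewrite -bDl !addr0. Qed.
Let b0r u : b u 0 = 0.
Proof. by apply: (@addrI _ (b u 0)); rewrite -bDr !addr0. Qed.
Let bZl a u v : b (a *: u) v = a *: b u v.
Proof. by have := b_bilin.1 v a u 0; rewrite b0l !addr0. Qed.
Let bZr a u v : b u (a *: v) = a *: b u v.
Proof. by have := b_bilin.2 u a v 0; rewrite b0r !addr0. Qed.

Lemma tensor_lift_funE s : tensor_lift_fun (tcls s) = \sum_(p <- s) b p.1 p.2.
Proof.
rewrite /tensor_lift_fun; move: (repr (tcls s)) (repr_eqv s) => t.
elim=> {s t} //=.
- by move=> t s s' _ -> _ ->.
- by move=> s s' t t' _ IHs _ IHt; rewrite !big_cat IHs IHt.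
- by move=> s t; rewrite !big_cat /= addrC.
- by move=> u u' v; rewrite !(big_cons, big_nil) /= !addr0.
- by move=> u v v'; rewrite !(big_cons, big_nil) /= !addr0.
- by move=> a u v; rewrite !(big_cons, big_nil) /= bZl bZr.
- by move=> v; rewrite !(big_cons, big_nil) /= b0l addr0.
Qed.

Fact tensor_lift_subproof : linear tensor_lift_fun.
Proof.
move=> a; elim/tcls_ind=> s; elim/tcls_ind=> t.
rewrite tclsZ tclsD !tensor_lift_funE big_cat big_map scaler_sumr.
by congr (_ + _); apply: eq_bigr => p _; rewrite bZl.
Qed.

Definition tensor_lift : LHom tensor W := mkLHom tensor_lift_subproof.

Lemma tensor_liftE u v : tensor_lift (pure u v) = b u v.
Proof. by rewrite /= tensor_lift_funE big_seq1. Qed.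

Lemma tensor_universal :
  exists! h : LHom tensor W, forall u v, h (pure u v) = b u v.
Proof.
exists tensor_lift; split=> [|h hE]; first exact: tensor_liftE.
by apply: tensor_ext => u v; rewrite tensor_liftE hE.
Qed.

End Lift.
End TensorProduct.


Section TensorMaps.
Variable k : comPzRingType.
Implicit Types U V W : lmodType k.

Fact hom_tensor_subproof U U' V V' (f : LHom U U') (g : LHom V V') :
  bilinear_map (fun u v => pure (f u) (g v)).
Proof.
have [lin_l lin_r] := @pure_bilinear k U' V'.
by split=> [v|u] a x y; rewrite linearP ?lin_l ?lin_r.
Qed.

Definition hom_tensor U U' V V' (f : LHom U U') (g : LHom V V') :
  LHom (tensor U V) (tensor U' V') := tensor_lift (hom_tensor_subproof f g).

Lemma hom_tensorE U U' V V' (f : LHom U U') (g : LHom V V') u v :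
  hom_tensor f g (pure u v) = pure (f u) (g v).
Proof. exact: tensor_liftE. Qed.

Fact pure_linear_r U V (u : U) : linear (@pure k U V u).
Proof. exact: (@pure_bilinear k U V).2. Qed.

Fact pure_linear_l U V (v : V) : linear (fun u : U => pure u v).
Proof. exact: (@pure_bilinear k U V).1. Qed.

Definition pure_r U V u : LHom V (tensor U V) := mkLHom (@pure_linear_r U V u).
Definition pure_l U V v : LHom U (tensor U V) := mkLHom (@pure_linear_l U V v).

Fact assoc_subproof U V W : bilinear_map (fun (x : tensor U V) (w : W) =>
  hom_tensor (@hom_id k U) (pure_l V w) x).
Proof.
split=> [w|x] a y z; first by rewrite linearP.
elim/tensor_ind: x => [|u v x IHx]; first by rewrite !hom0 scaler0 addr0.
rewrite !homD IHx !hom_tensorE /= !pure_linear_r scalerDr -!addrA.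
by congr (_ + _); rewrite addrCA.
Qed.

Definition tensor_assoc U V W :
    LHom (tensor (tensor U V) W) (tensor U (tensor V W)) :=
  tensor_lift (@assoc_subproof U V W).

Fact assoc_inv_subproof U V W : bilinear_map (fun (u : U) (y : tensor V W) =>
  hom_tensor (pure_r V u) (@hom_id k W) y).
Proof.
split=> [y|u] a x z; last by rewrite linearP.
elim/tensor_ind: y => [|v w y IHy]; first by rewrite !hom0 scaler0 addr0.
rewrite !homD IHy !hom_tensorE /= !pure_linear_l scalerDr -!addrA.
by congr (_ + _); rewrite addrCA.
Qed.

Definition tensor_assoc_inv U V W :
    LHom (tensor U (tensor V W)) (tensor (tensor U V) W) :=
  tensor_lift (@assoc_inv_subproof U V W).

Lemma tensor_assocE U V W (u : U) (v : V) (w : W) :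
  tensor_assoc U V W (pure (pure u v) w) = pure u (pure v w).
Proof. by rewrite tensor_liftE hom_tensorE. Qed.

Lemma tensor_assoc_invE U V W (u : U) (v : V) (w : W) :
  tensor_assoc_inv U V W (pure u (pure v w)) = pure (pure u v) w.
Proof. by rewrite tensor_liftE hom_tensorE. Qed.

Lemma tensor_assocK U V W :
  tensor_assoc_inv U V W \oh tensor_assoc U V W = hom_id.
Proof.
apply: tensor_ext => x w; elim/tensor_ind: x => [|u v x IHx].
  by rewrite -[pure 0 w]/(pure_l _ w 0) !hom0.
rewrite -[pure _ w]/(pure_l _ w (pure u v + x)) !homD.
by congr (_ + _); [rewrite hom_compE tensor_assocE tensor_assoc_invE | exact: IHx].
Qed.

Lemma tensor_assoc_invK U V W :
  tensor_assoc U V W \oh tensor_assoc_inv U V W = hom_id.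
Proof.
apply: tensor_ext => u x; elim/tensor_ind: x => [|v w x IHx].
  by rewrite -[pure u 0]/(pure_r _ u 0) !hom0.
rewrite -[pure u _]/(pure_r _ u (pure v w + x)) !homD.
by congr (_ + _); [rewrite hom_compE tensor_assoc_invE tensor_assocE | exact: IHx].
Qed.

End TensorMaps.

Arguments tensor_assoc {k U V W}.
Arguments tensor_assoc_inv {k U V W}.

Notation "f \ox g" := (hom_tensor f g) (at level 40, left associativity)
  : ring_scope.

Section BraidedAlgebra.
Variables (k : comPzRingType) (V : lmodType k).

Definition tensor2 : lmodType k := tensor V V.
Definition tensor3 : lmodType k := tensor tensor2 V.

(* The third tensor power is bracketed to the left, so 1 (x) f involves the    *)
(* associator.                                                                 *)
Definition op_id (f : LHom tensor2 tensor2) : LHom tensor3 tensor3 :=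
  f \ox hom_id.
Definition id_op (f : LHom tensor2 tensor2) : LHom tensor3 tensor3 :=
  tensor_assoc_inv \oh (hom_id \ox f) \oh tensor_assoc.
Definition mul_id (f : LHom tensor2 V) : LHom tensor3 tensor2 :=
  f \ox hom_id.
Definition id_mul (f : LHom tensor2 V) : LHom tensor3 tensor2 :=
  (hom_id \ox f) \oh tensor_assoc.

Definition invertible_hom U W (f : @LHom k U W) : Prop :=
  exists g : LHom W U, g \oh f = hom_id /\ f \oh g = hom_id.

Definition YB_operator (R : LHom tensor2 tensor2) : Prop :=
  invertible_hom R /\
  op_id R \oh id_op R \oh op_id R = id_op R \oh op_id R \oh id_op R.

(* Algebras are associative but not required to be unital. *)
Definition associative_mul (mu : LHom tensor2 V) : Prop :=
  mu \oh mul_id mu = mu \oh id_mul mu.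

Definition braided_algebra (mu : LHom tensor2 V) (R : LHom tensor2 tensor2) :
    Prop :=
  [/\ associative_mul mu,
      YB_operator R,
      id_mul mu \oh op_id R \oh id_op R = R \oh mul_id mu
    & mul_id mu \oh id_op R \oh op_id R = R \oh id_mul mu].

Definition C0_YBH : lmodType k := 'rV[k]_0.
Definition C1_YBH : lmodType k := LHom V V.
Definition C2_YBH : lmodType k := (LHom tensor2 tensor2 * LHom tensor2 V)%type.
Definition C3_YBH : lmodType k :=
  (LHom tensor3 tensor3 * LHom tensor3 tensor2 * LHom tensor3 tensor2
   * LHom tensor3 V)%type.

Variables (mu : LHom tensor2 V) (R : LHom tensor2 tensor2).
Implicit Types (f : LHom V V) (phi : LHom tensor2 tensor2) (psi : LHom tensor2 V).

Definition delta1_YB f : LHom tensor2 tensor2 :=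
  R \oh (f \ox hom_id) + R \oh (hom_id \ox f)
  - (f \ox hom_id) \oh R - (hom_id \ox f) \oh R.

Definition delta1_H f : LHom tensor2 V :=
  mu \oh (f \ox hom_id) + mu \oh (hom_id \ox f) - f \oh mu.

Definition delta2_YB phi : LHom tensor3 tensor3 :=
  op_id R \oh id_op R \oh op_id phi
  + op_id R \oh id_op phi \oh op_id R
  + op_id phi \oh id_op R \oh op_id R
  - id_op R \oh op_id R \oh id_op phi
  - id_op R \oh op_id phi \oh id_op R
  - id_op phi \oh op_id R \oh id_op R.

Definition delta2_H psi : LHom tensor3 V :=
  mu \oh mul_id psi + psi \oh mul_id mu
  - mu \oh id_mul psi - psi \oh id_mul mu.

Definition delta2_YI phi psi : LHom tensor3 tensor2 :=
  id_mul psi \oh op_id R \oh id_op R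
  + id_mul mu \oh op_id phi \oh id_op R
  + id_mul mu \oh op_id R \oh id_op phi
  - R \oh mul_id psi - phi \oh mul_id mu.

Definition delta2_IY phi psi : LHom tensor3 tensor2 :=
  mul_id psi \oh id_op R \oh op_id R
  + mul_id mu \oh id_op phi \oh op_id R
  + mul_id mu \oh id_op R \oh op_id phi
  - R \oh id_mul psi - phi \oh id_mul mu.

Definition delta0_YBH : C0_YBH -> C1_YBH := fun=> 0.

Definition delta1_YBH : C1_YBH -> C2_YBH :=
  fun f => (delta1_YB f, delta1_H f).

Definition delta2_YBH : C2_YBH -> C3_YBH :=
  fun c => (delta2_YB c.1, delta2_YI c.1 c.2, delta2_IY c.1 c.2, delta2_H c.2).

End BraidedAlgebra.

Definition cochain_complex (k : comPzRingType) (C0 C1 C2 C3 : lmodType k)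
    (d0 : C0 -> C1) (d1 : C1 -> C2) (d2 : C2 -> C3) : Prop :=
  [/\ linear d0, linear d1, linear d2,
      forall x, d1 (d0 x) = 0
    & forall x, d2 (d1 x) = 0].

(* Main.v *)
Require Import Defs.
From HB Require Import structures.
From mathcomp Require Import all_boot all_algebra.

(** Every defining equation of a braided algebra is an equality between two
composites built from [R] and [mu], and [delta2_YBH] is the linearization of
those equations: each of its components replaces, one factor at a time, [R] by
[phi] and [mu] by [psi].  An endomorphism [f] of [V] acts on each tensor power
of [V] by the operator T_n that applies [f] to one factor at a time and sums
the results ([tensor_sum] builds T_(m+n) from T_m and T_n), hence on every map
P between tensor powers by the commutator [P, f] = P T - T P
([hom_comm]).  By definition delta1 f is nothing but ([R, f], [mu, f]).

The commutator obeys the Leibniz rule for composition ([hom_comm_comp]) and for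
tensor products ([hom_comm_tensor]), and it kills identities and associators
([hom_comm_id], [hom_comm_assoc]).  So tensoring R or mu with an identity
commutes with taking commutators, and delta2 (delta1 f) has as its components
the commutators with [f] of the two sides of the Yang-Baxter, YI, IY and
associativity equations, subtracted from each other.  As the two sides are
equal, the components vanish.  Linearity of the differentials comes from the
bilinearity of composition and of the tensor product of maps. *)

Set Implicit Arguments.
Unset Strict Implicit.
Unset Printing Implicit Defensive.

Import GRing.Theory.
Local Open Scope ring_scope.

(** * Bilinearity of composition and of the tensor product of maps *)

Section Bilinearity.
Variable k : comPzRingType.
Implicit Types U V W : lmodType k.

Lemma lhom_linE U V a (f g : LHom U V) x : (a *: f + g) x = a *: f x + g x.
Proof. by []. Qed.

Lemma hom_comp_linear_l U V W (f : LHom U V) :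
  linear (fun g : LHom V W => g \oh f).
Proof. by move=> a g h; apply: homP. Qed.

Lemma hom_comp_linear_r U V W (g : LHom V W) :
  linear (fun f : LHom U V => g \oh f).
Proof. by move=> a f h; apply: homP => x; rewrite /= linearP. Qed.

Lemma hom_tensor_linear_l U U' V V' (g : LHom V V') :
  linear (fun f : LHom U U' => f \ox g).
Proof.
move=> a f h; apply: tensor_ext => u v.
by rewrite lhom_linE !hom_tensorE lhom_linE pure_linear_l.
Qed.

Lemma hom_tensor_linear_r U U' V V' (f : LHom U U') :
  linear (fun g : LHom V V' => f \ox g).
Proof.
move=> a g h; apply: tensor_ext => u v.
by rewrite lhom_linE !hom_tensorE lhom_linE pure_linear_r.
Qed.

End Bilinearity.

(** Unbundled forms, from which linearity of a differential can be assembled by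
following the syntax of its defining formula. *)
Section LinearCombinators.
Variable k : comPzRingType.
Implicit Types X U V W : lmodType k.

Lemma linear_add X U (F G : X -> U) :
  linear F -> linear G -> linear (fun x => F x + G x).
Proof. by move=> lF lG a x y; rewrite lF lG scalerDr addrACA. Qed.

Lemma linear_opp X U (F : X -> U) : linear F -> linear (fun x => - F x).
Proof. by move=> lF a x y; rewrite lF opprD scalerN. Qed.

Lemma linear_compose X U V (G : U -> V) (F : X -> U) :
  linear G -> linear F -> linear (fun x => G (F x)).
Proof. by move=> lG lF a x y; rewrite lF lG. Qed.

Lemma linear_pair X U V (F : X -> U) (G : X -> V) :
  linear F -> linear G -> linear (fun x => (F x, G x) : (U * V)%type).
Proof. by move=> lF lG a x y; rewrite lF lG. Qed.

Lemma linear_hom_comp_l X U V W (f : LHom U V) (G : X -> LHom V W) :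
  linear G -> linear (fun x => G x \oh f).
Proof. by move=> lG a x y; rewrite lG hom_comp_linear_l. Qed.

Lemma linear_hom_comp_r X U V W (g : LHom V W) (F : X -> LHom U V) :
  linear F -> linear (fun x => g \oh F x).
Proof. by move=> lF a x y; rewrite lF hom_comp_linear_r. Qed.

Lemma linear_hom_tensor_l X U U' V V' (g : LHom V V') (F : X -> LHom U U') :
  linear F -> linear (fun x => F x \ox g).
Proof. by move=> lF a x y; rewrite lF hom_tensor_linear_l. Qed.

Lemma linear_hom_tensor_r X U U' V V' (f : LHom U U') (G : X -> LHom V V') :
  linear G -> linear (fun x => f \ox G x).
Proof. by move=> lG a x y; rewrite lG hom_tensor_linear_r. Qed.

End LinearCombinators.

Section Additivity.
Variable k : comPzRingType.
Implicit Types U V W : lmodType k.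

Lemma linear_morphD U V (F : U -> V) : linear F -> {morph F : x y / x + y}.
Proof. by move=> lF x y; rewrite -[x]scale1r lF !scale1r. Qed.

Lemma linear_morph0 U V (F : U -> V) : linear F -> F 0 = 0.
Proof.
by move=> lF; apply: (@addrI _ (F 0)); rewrite -(linear_morphD lF) !addr0.
Qed.

Lemma linear_morphN U V (F : U -> V) : linear F -> {morph F : x / - x}.
Proof.
move=> lF x; apply: (@addrI _ (F x)).
by rewrite -(linear_morphD lF) !subrr (linear_morph0 lF).
Qed.

Lemma hom_compDl U V W (f : LHom U V) (g h : LHom V W) :
  (g + h) \oh f = g \oh f + h \oh f.
Proof. exact: (linear_morphD (hom_comp_linear_l f)). Qed.

Lemma hom_compDr U V W (g : LHom V W) (f h : LHom U V) :
  g \oh (f + h) = g \oh f + g \oh h.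
Proof. exact: (linear_morphD (hom_comp_linear_r g)). Qed.

Lemma hom_compNl U V W (f : LHom U V) (g : LHom V W) :
  (- g) \oh f = - (g \oh f).
Proof. exact: (linear_morphN (hom_comp_linear_l f)). Qed.

Lemma hom_compNr U V W (g : LHom V W) (f : LHom U V) :
  g \oh (- f) = - (g \oh f).
Proof. exact: (linear_morphN (hom_comp_linear_r g)). Qed.

Lemma hom_comp0l U V W (f : LHom U V) : (0 : LHom V W) \oh f = 0.
Proof. exact: (linear_morph0 (hom_comp_linear_l f)). Qed.

Lemma hom_comp0r U V W (g : LHom V W) : g \oh (0 : LHom U V) = 0.
Proof. exact: (linear_morph0 (hom_comp_linear_r g)). Qed.

Lemma hom_tensorDl U U' V V' (g : LHom V V') (f h : LHom U U') :
  (f + h) \ox g = f \ox g + h \ox g.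
Proof. exact: (linear_morphD (hom_tensor_linear_l g)). Qed.

Lemma hom_tensorDr U U' V V' (f : LHom U U') (g h : LHom V V') :
  f \ox (g + h) = f \ox g + f \ox h.
Proof. exact: (linear_morphD (hom_tensor_linear_r f)). Qed.

Lemma hom_tensorNl U U' V V' (g : LHom V V') (f : LHom U U') :
  (- f) \ox g = - (f \ox g).
Proof. exact: (linear_morphN (hom_tensor_linear_l g)). Qed.

Lemma hom_tensorNr U U' V V' (f : LHom U U') (g : LHom V V') :
  f \ox (- g) = - (f \ox g).
Proof. exact: (linear_morphN (hom_tensor_linear_r f)). Qed.

Lemma hom_tensor0l U U' V V' (g : LHom V V') : (0 : LHom U U') \ox g = 0.
Proof. exact: (linear_morph0 (hom_tensor_linear_l g)). Qed.

Lemma hom_tensor0r U U' V V' (f : LHom U U') : f \ox (0 : LHom V V') = 0.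
Proof. exact: (linear_morph0 (hom_tensor_linear_r f)). Qed.

End Additivity.

Section CategoryLaws.
Variable k : comPzRingType.
Implicit Types U V W X : lmodType k.

Lemma hom_compA U V W X (h : LHom W X) (g : LHom V W) (f : LHom U V) :
  h \oh (g \oh f) = h \oh g \oh f.
Proof. exact: homP. Qed.

Lemma hom_comp1l U V (f : LHom U V) : hom_id \oh f = f.
Proof. exact: homP. Qed.

Lemma hom_comp1r U V (f : LHom U V) : f \oh hom_id = f.
Proof. exact: homP. Qed.

Lemma hom_tensor_comp U U' U'' V V' V'' (f' : LHom U' U'') (f : LHom U U')
    (g' : LHom V' V'') (g : LHom V V') :
  (f' \ox g') \oh (f \ox g) = (f' \oh f) \ox (g' \oh g).
Proof.
by apply: tensor_ext => u v; rewrite hom_compE !hom_tensorE.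
Qed.

Lemma tensor3_ext U V W X (f g : LHom (tensor (tensor U V) W) X) :
  (forall u v w, f (pure (pure u v) w) = g (pure (pure u v) w)) -> f = g.
Proof.
move=> fg; apply: tensor_ext => x w.
have: f \oh pure_l _ w = g \oh pure_l _ w by apply: tensor_ext => u v; apply: fg.
by move/(congr1 (fun h : LHom _ _ => h x)).
Qed.

End CategoryLaws.

(** * Commutators with an operator on all tensor powers *)

Section Commutator.
Variable k : comPzRingType.
Implicit Types U V W X : lmodType k.

Definition hom_comm U V (D : LHom U U) (E : LHom V V) (P : LHom U V) :
  LHom U V := P \oh D - E \oh P.

Definition tensor_sum U V (D : LHom U U) (E : LHom V V) :
  LHom (tensor U V) (tensor U V) := D \ox hom_id + hom_id \ox E.

Lemma hom_comm_id U (D : LHom U U) : hom_comm D D hom_id = 0.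
Proof. by rewrite /hom_comm hom_comp1l hom_comp1r subrr. Qed.

(** The middle terms Q E P of the two summands cancel. *)
Lemma hom_comm_comp U V W (D : LHom U U) (E : LHom V V) (F : LHom W W)
    (Q : LHom V W) (P : LHom U V) :
  hom_comm D F (Q \oh P) = hom_comm E F Q \oh P + Q \oh hom_comm D E P.
Proof.
rewrite /hom_comm hom_compDl hom_compDr hom_compNl hom_compNr !hom_compA.
by rewrite [RHS]addrC addrA subrK.
Qed.

Lemma hom_comm_comp3 U V W X (D : LHom U U) (E : LHom V V) (F : LHom W W)
    (G : LHom X X) (r : LHom W X) (q : LHom V W) (p : LHom U V) :
  hom_comm D G (r \oh q \oh p)
    = hom_comm F G r \oh q \oh p + r \oh hom_comm E F q \oh p
      + r \oh q \oh hom_comm D E p.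
Proof.
rewrite (hom_comm_comp D E) (hom_comm_comp E F G).
by rewrite (hom_compDl p (_ \oh q)).
Qed.

Lemma hom_comm_tensor U U' V V' (D : LHom U U) (D' : LHom U' U')
    (E : LHom V V) (E' : LHom V' V') (P : LHom U U') (Q : LHom V V') :
  hom_comm (tensor_sum D E) (tensor_sum D' E') (P \ox Q)
    = hom_comm D D' P \ox Q + P \ox hom_comm E E' Q.
Proof.
rewrite /hom_comm /tensor_sum hom_compDl hom_compDr !hom_tensor_comp.
rewrite !hom_comp1l !hom_comp1r.
by rewrite hom_tensorDl hom_tensorDr hom_tensorNl hom_tensorNr opprD addrACA.
Qed.

(** Both bracketings of a triple tensor carry the same operator: on
u (x) v (x) w it applies D, E and F to one factor each and sums. *)
Lemma hom_comm_assoc U V W (D : LHom U U) (E : LHom V V) (F : LHom W W) :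
  hom_comm (tensor_sum (tensor_sum D E) F) (tensor_sum D (tensor_sum E F))
    tensor_assoc = 0.
Proof.
apply/eqP; rewrite subr_eq0; apply/eqP; apply: tensor3_ext => u v w.
rewrite /tensor_sum !(hom_tensorDl, hom_tensorDr) !(hom_compDl, hom_compDr).
have addE A B (f g : LHom A B) x : (f + g) x = f x + g x by [].
rewrite !addE !hom_compE !(hom_tensorE, tensor_assocE).
by rewrite addrA.
Qed.

(** The commutator of an inverse g is - g [f, _] g, so it vanishes with that
of f. *)
Lemma hom_comm_inv U V (D : LHom U U) (E : LHom V V) (f : LHom U V)
    (g : LHom V U) :
  g \oh f = hom_id -> f \oh g = hom_id ->
  hom_comm D E f = 0 -> hom_comm E D g = 0.
Proof.
move=> gf fg fDE; have := hom_comm_id E.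
rewrite -fg (hom_comm_comp _ D) fDE hom_comp0l add0r.
move/(congr1 (hom_comp g)).
by rewrite hom_comp0r hom_compA gf hom_comp1l.
Qed.

Lemma hom_comm_assoc_inv U V W (D : LHom U U) (E : LHom V V) (F : LHom W W) :
  hom_comm (tensor_sum D (tensor_sum E F)) (tensor_sum (tensor_sum D E) F)
    tensor_assoc_inv = 0.
Proof.
exact: hom_comm_inv (tensor_assocK U V W) (tensor_assoc_invK U V W)
  (hom_comm_assoc D E F).
Qed.

End Commutator.

(** * The differentials of a braided algebra *)

Section BraidedDifferentials.
Variables (k : comPzRingType) (V : lmodType k).
Variables (mu : LHom (tensor2 V) V) (R : LHom (tensor2 V) (tensor2 V)).

Lemma op_id_linear : linear (@op_id k V).
Proof. exact: hom_tensor_linear_l. Qed.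

Lemma id_op_linear : linear (@id_op k V).
Proof.
exact/linear_hom_comp_l/linear_hom_comp_r/hom_tensor_linear_r.
Qed.

Lemma mul_id_linear : linear (@mul_id k V).
Proof. exact: hom_tensor_linear_l. Qed.

Lemma id_mul_linear : linear (@id_mul k V).
Proof. exact/linear_hom_comp_l/hom_tensor_linear_r. Qed.

Lemma delta1_YBH_linear : linear (delta1_YBH mu R).
Proof.
have id_lin : linear (@id (LHom V V)) by [].
apply: linear_pair; rewrite /delta1_YB /delta1_H;
repeat first [ exact: id_lin | apply: linear_add | apply: linear_opp
  | apply: linear_hom_comp_r | apply: linear_hom_comp_l
  | apply: linear_hom_tensor_l | apply: linear_hom_tensor_r ].
Qed.

Lemma delta2_YBH_linear : linear (delta2_YBH mu R).
Proof.
have fst_lin : linear (fun c : C2_YBH V => c.1) by [].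
have snd_lin : linear (fun c : C2_YBH V => c.2) by [].
do 3?apply: linear_pair;
rewrite /delta2_YB /delta2_YI /delta2_IY /delta2_H;
repeat first [ exact: (linear_compose op_id_linear fst_lin)
  | exact: (linear_compose id_op_linear fst_lin)
  | exact: (linear_compose mul_id_linear snd_lin)
  | exact: (linear_compose id_mul_linear snd_lin)
  | exact: fst_lin | exact: snd_lin
  | apply: linear_add | apply: linear_opp
  | apply: linear_hom_comp_r | apply: linear_hom_comp_l ].
Qed.

Variable f : LHom V V.

Let T2 : LHom (tensor2 V) (tensor2 V) := tensor_sum f f.
Let T3 : LHom (tensor3 V) (tensor3 V) := tensor_sum T2 f.

Lemma delta1_YBE : delta1_YB R f = hom_comm T2 T2 R.
Proof.
by rewrite /delta1_YB /hom_comm hom_compDr hom_compDl opprD addrA.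
Qed.

Lemma delta1_HE : delta1_H mu f = hom_comm T2 f mu.
Proof. by rewrite /delta1_H /hom_comm hom_compDr. Qed.

(** In the next four lemmas the factor left alone contributes nothing, its
commutator being that of an identity. *)
Lemma op_id_comm : op_id (hom_comm T2 T2 R) = hom_comm T3 T3 (op_id R).
Proof. by rewrite /op_id hom_comm_tensor hom_comm_id hom_tensor0r addr0. Qed.

Lemma mul_id_comm : mul_id (hom_comm T2 f mu) = hom_comm T3 T2 (mul_id mu).
Proof. by rewrite /mul_id hom_comm_tensor hom_comm_id hom_tensor0r addr0. Qed.

Lemma id_op_comm : id_op (hom_comm T2 T2 R) = hom_comm T3 T3 (id_op R).
Proof.
(* [T2'] acts between the two associators, on V (x) (V (x) V). *)
pose T2' := tensor_sum f T2.
rewrite /id_op (hom_comm_comp _ T2') hom_comm_assoc hom_comp0r addr0.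
rewrite (hom_comm_comp _ T2') hom_comm_assoc_inv hom_comp0l add0r.
by rewrite hom_comm_tensor hom_comm_id hom_tensor0l add0r.
Qed.

Lemma id_mul_comm : id_mul (hom_comm T2 f mu) = hom_comm T3 T2 (id_mul mu).
Proof.
rewrite /id_mul (hom_comm_comp _ (tensor_sum f T2)) hom_comm_assoc hom_comp0r.
by rewrite addr0 hom_comm_tensor hom_comm_id hom_tensor0l add0r.
Qed.

(** The three terms of [delta2_YB] with a plus sign are the Leibniz expansion
of the left side of the Yang-Baxter equation, those with a minus sign that of
the right side; the other components of the differential are read in the same
way. *)
Lemma delta2_YB_comm :
  delta2_YB R (hom_comm T2 T2 R)
    = hom_comm T3 T3 (op_id R \oh id_op R \oh op_id R)
      - hom_comm T3 T3 (id_op R \oh op_id R \oh id_op R).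
Proof.
rewrite /delta2_YB op_id_comm id_op_comm !(hom_comm_comp3 T3 T3 T3).
have rev (M : zmodType) (x y z : M) : x + y + z = z + y + x.
  by rewrite addrC [x + y]addrC addrA.
by rewrite [X in _ = X - _]rev [X in _ = _ - X]rev !opprD !addrA.
Qed.

Lemma delta2_YI_comm :
  delta2_YI mu R (hom_comm T2 T2 R) (hom_comm T2 f mu)
    = hom_comm T3 T2 (id_mul mu \oh op_id R \oh id_op R)
      - hom_comm T3 T2 (R \oh mul_id mu).
Proof.
rewrite /delta2_YI op_id_comm id_op_comm id_mul_comm mul_id_comm.
rewrite (hom_comm_comp3 T3 T3 T3) (hom_comm_comp T3 T2 T2).
by rewrite opprD !addrA addrAC.
Qed.

Lemma delta2_IY_comm :
  delta2_IY mu R (hom_comm T2 T2 R) (hom_comm T2 f mu)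
    = hom_comm T3 T2 (mul_id mu \oh id_op R \oh op_id R)
      - hom_comm T3 T2 (R \oh id_mul mu).
Proof.
rewrite /delta2_IY op_id_comm id_op_comm id_mul_comm mul_id_comm.
rewrite (hom_comm_comp3 T3 T3 T3) (hom_comm_comp T3 T2 T2).
by rewrite opprD !addrA addrAC.
Qed.

Lemma delta2_H_comm :
  delta2_H mu (hom_comm T2 f mu)
    = hom_comm T3 f (mu \oh mul_id mu) - hom_comm T3 f (mu \oh id_mul mu).
Proof.
rewrite /delta2_H id_mul_comm mul_id_comm !(hom_comm_comp T3 T2 f).
by rewrite opprD !addrA [X in X - _ - _]addrC addrAC.
Qed.

End BraidedDifferentials.

Theorem proposition3p3 (k : comPzRingType) (V : lmodType k)
    (mu : LHom (tensor2 V) V) (R : LHom (tensor2 V) (tensor2 V))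
    (hV : braided_algebra mu R) :
  cochain_complex (@delta0_YBH k V) (delta1_YBH mu R) (delta2_YBH mu R).
Proof.
case: hV => assoc_mu [_ ybR] yi iy; split.
- by move=> a x y; rewrite /delta0_YBH scaler0 addr0.
- exact: delta1_YBH_linear.
- exact: delta2_YBH_linear.
- by move=> x; apply: linear_morph0; apply: delta1_YBH_linear.
- move=> f; rewrite /delta2_YBH /= delta1_YBE delta1_HE.
  rewrite delta2_YB_comm delta2_YI_comm delta2_IY_comm delta2_H_comm.
  by rewrite ybR yi iy assoc_mu !subrr.
Qed.
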